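(* Let $n\in\mathbb{N}$, $\varepsilon_0>0$, let $\mathcal{D}$ be a domain, and let $\mathcal{R}^{(1)},\dots,\mathcal{R}^{(n)}$ be such that $\mathcal{R}^{(i)}(z_{1:i-1},\cdot)$ is an $\varepsilon_0$-DP local randomizer for every $i$ and every auxiliary input $z_{1:i-1}$; let $\mathcal{A}_{\rm s}$ be the corresponding shuffled adaptive protocol. Let $X_0,X_1\in\mathcal{D}^n$ be arbitrary neighboring datasets. Let $C\sim\mathrm{Bin}(n-1,e^{-\varepsilon_0})$, conditionally on $C$ let $A\sim\mathrm{Bin}(C,1/2)$, and let $\Delta\sim\mathrm{Bern}\left(\frac{e^{\varepsilon_0}}{e^{\varepsilon_0}+1}\right)$ be independent of $(C,A)$. Then there exists a randomized post-processing algorithm $\Phi$ (depending on $X_0,X_1$ and the randomizers) such that $\mathcal{A}_{\rm s}(X_0)$ is distributed identically to $\Phi(A+\Delta,\,C-A+1-\Delta)$ and $\mathcal{A}_{\rm s}(X_1)$ is distributed identically to $\Phi(A+1-\Delta,\,C-A+\Delta)$.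
   Context: A randomized algorithm $\mathcal{R}:\mathcal{D}\to\mathcal{S}$ is an $\varepsilon$-DP local randomizer if for all $x,x'\in\mathcal{D}$ and all events $E$, $\Pr(\mathcal{R}(x)\in E)\le e^{\varepsilon}\Pr(\mathcal{R}(x')\in E)$. Datasets in $\mathcal{D}^n$ are neighboring if they differ in exactly one coordinate. Shuffled adaptive protocol: for $i\in[n]$, $\mathcal{R}^{(i)}:\mathcal{S}^{(1)}\times\cdots\times\mathcal{S}^{(i-1)}\times\mathcal{D}\to\mathcal{S}^{(i)}$ is a randomized algorithm; $\mathcal{A}_{\rm s}$, given $x_{1:n}\in\mathcal{D}^n$, samples a uniformly random permutation $\pi$ of $[n]$, then sequentially computes $z_i=\mathcal{R}^{(i)}(z_{1:i-1},x_{\pi(i)})$ for $i=1,\dots,n$ and outputs $z_{1:n}$. $\mathrm{Bin}(m,p)$ is the binomial distribution and $\mathrm{Bern}(p)$ the Bernoulli distribution with bias $p$. *)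

(* Defs.v *)
From HB Require Import structures.
From mathcomp Require Import all_boot all_order all_algebra all_fingroup.
From mathcomp Require Import all_classical all_reals all_analysis.
Set Implicit Arguments. Unset Strict Implicit. Unset Printing Implicit Defensive.
Import Order.TTheory GRing.Theory Num.Theory.
Local Open Scope classical_set_scope.
Local Open Scope ring_scope.

Fixpoint hist_disp (Sd : nat -> measure_display) (k : nat) : measure_display :=
  match k with
  | 0 => default_measure_display
  | k'.+1 => (hist_disp Sd k', Sd k').-prod
  end.

(* hist S k = S 0 * ... * S (k-1) (nested to the left, starting from unit):
   the space of auxiliary inputs z_{1:k} of the (k+1)-th randomizer.
   S i is the output space of the (i+1)-th randomizer (0-based indexing). *)
Fixpoint hist (Sd : nat -> measure_display) (S : forall i, measurableType (Sd i))
  (k : nat) : measurableType (hist_disp Sd k) :=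
  match k with
  | 0 => unit
  | k'.+1 => (hist S k' * S k')%type
  end.

Definition dp_local_randomizer {R : realType} {dD dS} {D : measurableType dD}
  {S : measurableType dS} (eps : R) (Q : D -> {measure set S -> \bar R}) : Prop :=
  forall (x x' : D) (E : set S), measurable E ->
    (Q x E <= (expR eps)%:E * Q x' E)%E.

Definition neighboring {D : Type} {n : nat} (X0 X1 : 'I_n -> D) : Prop :=
  exists i : 'I_n, X0 i <> X1 i /\ forall j : 'I_n, j <> i -> X0 j = X1 j.

Section shuffle.
Context {R : realType} {dD} {D : measurableType dD}
  (Sd : nat -> measure_display) (S : forall i, measurableType (Sd i))
  (Rz : forall k : nat, R.-pker (hist S k * D)%type ~> S k)
  (n : nat).

(* Given the permutation pi and dataset X, [run X pi k f] is the expectation of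
   f(z_{1:k}) where z_{i+1} = R^{(i+1)}(z_{1:i}, x_{pi(i+1)}) sequentially. *)
Fixpoint run (X : 'I_n -> D) (pi : {perm 'I_n}) (k : nat) :
    (hist S k -> \bar R) -> \bar R :=
  match k return (hist S k -> \bar R) -> \bar R with
  | 0 => fun f => f tt
  | k'.+1 => fun f =>
      run X pi (fun z : hist S k' =>
        match (insub k' : option 'I_n) with
        | Some i => (\int[Rz k' (z, X (pi i))]_s f (z, s))%E
        | None => 0%E
        end)
  end.

Definition shuffle_law (X : 'I_n -> D) (E : set (hist S n)) : \bar R :=
  ((n`!%:R)^-1%:E * \sum_(pi : {perm 'I_n}) run X pi (fun z => (\1_E z)%:E))%E.

End shuffle.

Definition CADelta_pmf {R : realType} (n : nat) (eps0 : R)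
  (c a : nat) (delta : bool) : R :=
  binomial_pmf n.-1 (expR (- eps0)) c * binomial_pmf c (2^-1) a
  * bernoulli_pmf (expR eps0 / (expR eps0 + 1)) delta.

(* Main.v *)
(**
With p = exp(-eps0), each randomizer R^{(k)}(z, .) splits into probability
kernels: R(X0 i0) = q Q1 + (1 - q) Q0 and R(X1 i0) = (1 - q) Q1 + q Q0 with
q = exp(eps0) / (exp(eps0) + 1), and, for every other user,
R(x) = (p / 2) Q1 + (p / 2) Q0 + (1 - p) L(x). The remainders are nonnegative
by eps0-DP. Expanding all rounds, the protocol first assigns one component to
each user and then shuffles; user i0 is never assigned a leftover component.
Since Q1 and Q0 do not depend on the user, exchanging the components of i0 and
of another user with a shared component does not change the shuffled law.
Hence, averaged over the assignments with C shared components outside i0, A of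
them equal to Q1, the law depends only on the total numbers of Q1's and Q0's,
whichever component i0 has; this average is Phi. The two datasets differ only
in the weights of the component of i0.
*)

Require Import Defs.
From HB Require Import structures.
From mathcomp Require Import all_boot all_order all_algebra all_fingroup.
From mathcomp Require Import all_classical all_reals all_analysis.
From mathcomp Require Import measurable_realfun.
From mathcomp Require Import ring lra zify.
Set Implicit Arguments.
Unset Strict Implicit.
Unset Printing Implicit Defensive.
Import Order.TTheory GRing.Theory Num.Theory.
Import numFieldNormedType.Exports.
Local Open Scope classical_set_scope.
Local Open Scope ring_scope.

(** * Probabilities and kernels from set functions and signed combinations *)

Lemma probability_of_set_function d (T : measurableType d) (R : realType)
    (mu : set T -> \bar R) :
  mu set0 = 0%E -> (forall U, (0 <= mu U)%E) -> semi_sigma_additive mu ->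
  mu setT = 1%E ->
  exists P : probability T R, forall U, P U = mu U.
Proof.
move=> mu0 mu_ge0 mu_sa mu1.
pose mm := isMeasure.Build _ _ _ mu mu0 mu_ge0 mu_sa.
pose m : {measure set T -> \bar R} := HB.pack mu mm.
pose p : probability T R :=
  HB.pack mu mm (Measure_isProbability.Build _ _ _ m mu1).
by exists p.
Qed.

Lemma pker_of_probability d d' (X : measurableType d) (Y : measurableType d')
    (R : realType) (P : X -> probability Y R) :
  (forall U, measurable U -> measurable_fun [set: X] (P ^~ U)) ->
  exists K : R.-pker X ~> Y, forall x U, K x U = P x U.
Proof.
move=> mP.
pose k0 : X -> {measure set Y -> \bar R} := fun x => P x.
pose km := isKernel.Build _ _ _ _ _ k0 mP.
pose k : R.-ker X ~> Y := HB.pack k0 km.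
have k1 : forall x, k x [set: Y] = 1%E by move=> x; exact: probability_setT.
pose p : R.-pker X ~> Y :=
  HB.pack k0 km (Kernel_isProbability.Build _ _ _ _ _ k k1).
by exists p.
Qed.

(** The coefficients may be negative; nonnegativity is asked of the combination itself. Countable
    additivity survives because the sum over [I] is finite and each [P i] takes finite values, so
    limits pass through it. *)
Lemma combination_probability d (T : measurableType d) (R : realType)
    (I : finType) (c : I -> R) (P : I -> probability T R) :
  (forall U, measurable U -> 0 <= \sum_i c i * fine (P i U)) ->
  \sum_i c i = 1 ->
  exists Q : probability T R, forall U, measurable U ->
    Q U = (\sum_i c i * fine (P i U))%:E.
Proof.
move=> c_ge0 c1.
(* Off the measurable sets the combination could be negative, so the set function is set to 0
   there. *)
pose mu U : \bar R :=
  (if pselect (measurable U) then \sum_i c i * fine (P i U) else 0)%:E.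
have muE U : measurable U -> mu U = (\sum_i c i * fine (P i U))%:E.
  by rewrite /mu; case: pselect.
have [|U|F mF tF mUF||Q QE] := @probability_of_set_function d T R mu.
- rewrite muE//; congr _%:E; apply: big1 => i _.
  by rewrite measure0 mulr0.
- by rewrite /mu lee_fin; case: pselect => // mU; exact: c_ge0.
- rewrite muE//.
  rewrite [X in X @ _ --> _](_ : _ = EFin \o
    fun n => \sum_i c i * fine (\sum_(0 <= j < n) P i (F j))%E); last first.
    apply/funext => n /=; under eq_bigr do rewrite muE//.
    rewrite sumEFin exchange_big/=; congr _%:E; apply: eq_bigr => i _.
    rewrite -mulr_sumr sum_fine//= => j _.
    exact: fin_num_measure.
  apply: cvg_EFin; first by apply: nearW.
  apply: cvg_big => [|i _]; first exact: add_continuous.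
  apply: cvgMr; apply: fine_cvg.
  rewrite fineK ?fin_num_measure//.
  exact: measure_semi_sigma_additive.
- rewrite muE// -c1; congr _%:E; apply: eq_bigr => i _.
  by rewrite probability_setT mulr1.
by exists Q => U mU; rewrite QE muE.
Qed.

Lemma combination_pker d d' (X : measurableType d) (Y : measurableType d')
    (R : realType) (I : finType) (c : I -> R) (P : I -> R.-pker X ~> Y) :
  (forall x U, measurable U -> 0 <= \sum_i c i * fine (P i x U)) ->
  \sum_i c i = 1 ->
  exists K : R.-pker X ~> Y, forall x U, measurable U ->
    K x U = (\sum_i c i * fine (P i x U))%:E.
Proof.
move=> c_ge0 c1.
have PP i x : exists Q : probability Y R, forall U, Q U = P i x U.
  apply: probability_of_set_function => //; last exact: prob_kernel.
  exact: measure_semi_sigma_additive.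
have /choice[Q0 Q0E] : forall ix, exists Q : probability Y R,
    forall U, Q U = P ix.1 ix.2 U by move=> [i x]; exact: PP.
have Q0fine i x U : fine (Q0 (i, x) U) = fine (P i x U) by rewrite Q0E.
have /choice[Q QE] : forall x, exists Q : probability Y R,
    forall U, measurable U -> Q U = (\sum_i c i * fine (P i x U))%:E.
  move=> x; have [U mU||Q QE] :=
    @combination_probability _ _ R I c (fun i => Q0 (i, x)).
  - by under eq_bigr do rewrite Q0fine; exact: c_ge0.
  - exact: c1.
  exists Q => U mU; rewrite QE//.
  by under eq_bigr do rewrite Q0fine.
have [U mU|K KE] := @pker_of_probability _ _ X Y R Q.
  under eq_fun do rewrite QE//.
  apply/measurable_EFinP; apply: measurable_sum => i.
  apply: measurable_funM => //.
  apply: measurableT_comp => //.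
  exact: measurable_kernel.
by exists K => x U mU; rewrite KE QE.
Qed.

Lemma integral_mixture d (Y : measurableType d) (R : realType) (T : finType)
    (m : {measure set Y -> \bar R}) (c : T -> R)
    (mu : T -> {measure set Y -> \bar R}) (f : Y -> \bar R) :
  (forall x, 0 <= c x) ->
  (forall U, measurable U -> m U = \sum_x (c x)%:E * mu x U)%E ->
  (forall y, 0 <= f y)%E -> measurable_fun setT f ->
  (\int[m]_y f y = \sum_x (c x)%:E * \int[mu x]_y f y)%E.
Proof.
move=> c0 mE f0 mf.
(* [msum] takes measures indexed by [nat], so [T] is enumerated, with [mzero] past the end. *)
pose mu_ (i : nat) : {measure set Y -> \bar R} :=
  if insub i is Some k then
    mscale (NngNum (c0 (enum_val (k : 'I_#|T|)))) (mu (enum_val k))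
  else mzero.
rewrite (@eq_measure_integral _ _ _ _ (msum mu_ #|T|)); last first.
  move=> A mA _; rewrite mE// /msum/=.
  rewrite (reindex _ (onW_bij _ (@enum_val_bij T)))//=.
  apply: eq_bigr => k _.
  by rewrite /mu_ valK.
rewrite ge0_integral_measure_sum//.
rewrite [RHS](reindex _ (onW_bij _ (@enum_val_bij T)))//=.
apply: eq_bigr => k _.
by rewrite /mu_ valK ge0_integral_mscale.
Qed.

(** * Resampling one coordinate of a product distribution *)

Section resampling.
Context {R : realType} {I T : finType} (w : I -> T -> R).
Hypothesis w_ge0 : forall i x, 0 <= w i x.
Hypothesis w_sum1 : forall i, \sum_x w i x = 1.

Definition ffset (t : {ffun I -> T}) (j : I) (x : T) : {ffun I -> T} :=
  [ffun i => if i == j then x else t i].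

Definition ffprob (t : {ffun I -> T}) : R := \prod_i w i (t i).

Lemma ffprob_ge0 t : 0 <= ffprob t.
Proof. by apply: prodr_ge0 => i _; exact: w_ge0. Qed.

Lemma sum_ffprob : \sum_t ffprob t = 1.
Proof. by rewrite -bigA_distr_bigA big1. Qed.

(** Both sides are the weights away from [j] times [w j x * w j (t j)]. *)
Lemma ffset_swap_weight t j x :
  ffprob (ffset t j x) * w j (t j) = ffprob t * w j x.
Proof.
rewrite /ffprob (bigD1 j)//= [in RHS](bigD1 j)//= ffunE eqxx.
under eq_bigr => i ij do rewrite ffunE (negbTE ij).
by rewrite mulrAC [RHS]mulrAC; congr (_ * _); exact: mulrC.
Qed.

(* Exchanging the coordinate [t j] with an independent copy [x] is an
   involution that preserves the weights. *)
Lemma sum_ffprob_resample (G : {ffun I -> T} -> T -> \bar R) (j : I) :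
  (forall t x, (0 <= G t x)%E) -> (forall t x y, G (ffset t j x) y = G t y) ->
  (\sum_t (ffprob t)%:E * \sum_x (w j x)%:E * G t x =
   \sum_t (ffprob t)%:E * G t (t j))%E.
Proof.
move=> G0 Gj.
transitivity (\sum_(p : {ffun I -> T} * T)
    ((ffprob p.1 * w j p.2)%:E * G p.1 p.2))%E.
  rewrite -(pair_bigA _ (fun t x => (ffprob t * w j x)%:E * G t x)%E)/=.
  apply: eq_bigr => t _.
  rewrite ge0_sume_distrr; last by move=> x _; rewrite mule_ge0 ?lee_fin.
  by apply: eq_bigr => x _; rewrite muleA EFinM.
pose h (p : {ffun I -> T} * T) := (ffset p.1 j p.2, p.1 j).
have hK : involutive h.
  move=> [t x]; rewrite /h/= ffunE eqxx; congr pair.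
  by apply/ffunP => i; rewrite !ffunE; case: eqP => [->|].
rewrite (reindex_inj (inv_inj hK))/=.
under eq_bigr do rewrite Gj ffset_swap_weight.
rewrite -(pair_bigA _ (fun t x => (ffprob t * w j x)%:E * G t (t j))%E)/=.
apply: eq_bigr => t _.
rewrite -ge0_sume_distrl; last first.
  by move=> x _; rewrite lee_fin mulr_ge0// ffprob_ge0.
by rewrite sumEFin -mulr_sumr w_sum1 mulr1.
Qed.

End resampling.

(** * Sequential composition of kernels *)

Section compose.
Context {R : realType} (Sd : nat -> measure_display)
  (S : forall i, measurableType (Sd i)).
Implicit Type K : forall k, R.-pker hist S k ~> S k.

(** The expectation is encoded as a functional, integrating from the last round inwards exactly as
    [run] does, so that the two unfold together by induction. *)
Fixpoint compose K (k : nat) : (hist S k -> \bar R) -> \bar R :=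
  match k return (hist S k -> \bar R) -> \bar R with
  | 0 => fun f => f tt
  | k'.+1 => fun f => compose K (fun z => \int[K k' z]_s f (z, s))%E
  end.

Lemma compose_ge0 K k f : (forall z, 0 <= f z)%E -> (0 <= @compose K k f)%E.
Proof.
elim: k f => [|k IH] f f0 //=.
by apply: IH => z; apply: integral_ge0 => s _.
Qed.

Lemma eq_compose K K' k f : (forall i, (i < k)%N -> K i = K' i) ->
  @compose K k f = @compose K' k f.
Proof.
elim: k f => [//|k IH] f KK' /=.
by rewrite KK'//; apply: IH => i ik; apply: KK'; exact: ltnW.
Qed.

Lemma measurable_integral_pker K k (f : hist S k.+1 -> \bar R) :
  (forall z, 0 <= f z)%E -> measurable_fun setT f ->
  measurable_fun setT (fun z => \int[K k z]_s f (z, s))%E.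
Proof. by move=> f0 mf; exact: measurable_fun_integral_finite_kernel. Qed.

Lemma measurable_pair_snd k (f : hist S k.+1 -> \bar R) (z : hist S k) :
  measurable_fun setT f -> measurable_fun setT (fun s : S k => f (z, s)).
Proof. by move=> mf; exact: measurableT_comp. Qed.

Lemma compose_sum K (I : finType) k (f : I -> hist S k -> \bar R) :
  (forall i z, 0 <= f i z)%E -> (forall i, measurable_fun setT (f i)) ->
  @compose K k (fun z => \sum_i f i z)%E = (\sum_i @compose K k (f i))%E.
Proof.
elim: k f => [//|k IH] f f0 mf /=.
rewrite -IH.
- congr compose; apply/funext => z; rewrite ge0_integral_sum//.
  by move=> i; exact: measurable_pair_snd.
- by move=> i z; apply: integral_ge0.
- by move=> i; exact: measurable_integral_pker.
Qed.

Lemma composeZ K k (c : \bar R) f : (0 <= c)%E ->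
  (forall z, 0 <= f z)%E -> measurable_fun setT f ->
  @compose K k (fun z => c * f z)%E = (c * @compose K k f)%E.
Proof.
move=> c0; elim: k f => [//|k IH] f f0 mf /=.
rewrite -IH.
- congr compose; apply/funext => z; rewrite ge0_integralZl//.
  exact: measurable_pair_snd.
- by move=> z; apply: integral_ge0.
- exact: measurable_integral_pker.
Qed.

Lemma compose_nneseries K k (f : nat -> hist S k -> \bar R) :
  (forall i z, 0 <= f i z)%E -> (forall i, measurable_fun setT (f i)) ->
  @compose K k (fun z => \sum_(i <oo) f i z)%E =
  (\sum_(i <oo) @compose K k (f i))%E.
Proof.
elim: k f => [//|k IH] f f0 mf /=.
rewrite -IH.
- congr compose; apply/funext => z; rewrite integral_nneseries//.
  by move=> i; exact: measurable_pair_snd.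
- by move=> i z; apply: integral_ge0.
- by move=> i; exact: measurable_integral_pker.
Qed.

Lemma compose1 K k : @compose K k (fun=> 1%E) = 1%E.
Proof.
elim: k => [//|k IH] /=; rewrite -[RHS]IH; congr compose; apply/funext => z.
by rewrite integral_cst// mul1e prob_kernel.
Qed.

(** Countable additivity is [compose_nneseries] applied to indicators of disjoint sets. *)
Lemma compose_probability K k : exists P : probability (hist S k) R,
  forall E, P E = @compose K k (fun z => (\1_E z)%:E).
Proof.
apply: probability_of_set_function.
- transitivity (@compose K k (fun z => 0 * (cst 1 z))%E).
    by congr compose; apply/funext => z; rewrite indic0 mul0e.
  by rewrite composeZ ?mul0e// => z; rewrite lee_fin.
- by move=> E; apply: compose_ge0 => z; rewrite lee_fin.
- move=> F mF tF mUF.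
  rewrite [X in _ --> X](_ : _ = \sum_(i <oo)
      @compose K k (fun z => (\1_(F i) z)%:E))%E.
    by apply: is_cvg_ereal_nneg_natsum_cond => i _ _;
      apply: compose_ge0 => z; rewrite lee_fin.
  rewrite -compose_nneseries.
  + by congr compose; apply/funext => z; rewrite indic_bigcup.
  + by move=> i z; rewrite lee_fin.
  + by move=> i; apply/measurable_EFinP; exact: measurable_indic.
- rewrite -[RHS](compose1 K k); congr compose; apply/funext => z.
  by rewrite indicT.
Qed.

End compose.

(** * Drawing all components before the rounds *)

Section expansion.
Context {R : realType} {dD} {D : measurableType dD}
  (Sd : nat -> measure_display) (S : forall i, measurableType (Sd i))
  (Rz : forall k : nat, R.-pker (hist S k * D)%type ~> S k) (n : nat).
Context {T : finType} (w : 'I_n -> T -> R)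
  (K : forall k : nat, T -> 'I_n -> R.-pker hist S k ~> S k) (j0 : 'I_n).
Hypothesis w_ge0 : forall i x, 0 <= w i x.
Hypothesis w_sum1 : forall i, \sum_x w i x = 1.

(* [j0] is a junk value for [n <= k]. *)
Definition select_pker (pi : {perm 'I_n}) (t : {ffun 'I_n -> T}) (k : nat) :
    R.-pker hist S k ~> S k :=
  let j := pi (odflt j0 (insub k)) in K k (t j) j.

(** A round draws the component of its user when it is reached; since a permutation serves each user
    once, all components can be drawn independently up front. The induction splits the last integral
    and merges its fresh component into [t]. *)
Lemma run_mixture (X : 'I_n -> D) (pi : {perm 'I_n}) k f :
  (forall k, (k < n)%N -> forall j (z : hist S k) U, measurable U ->
     Rz k (z, X j) U = \sum_x (w j x)%:E * K k x j z U)%E ->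
  (k <= n)%N -> (forall z, 0 <= f z)%E -> measurable_fun setT f ->
  (@run _ _ _ _ _ Rz n X pi k f =
   \sum_t (ffprob w t)%:E * @compose _ _ _ (select_pker pi t) k f)%E.
Proof.
move=> RzE; elim: k f => [|k IH] f kn f0 mf.
  rewrite /= -ge0_sume_distrl ?sumEFin ?sum_ffprob ?mul1e// => t _.
  by rewrite lee_fin ffprob_ge0.
have jE : insub k = Some (Ordinal kn) by rewrite insubT.
pose j := pi (Ordinal kn).
pose h x z := (\int[K k x j z]_s f (z, s))%E.
have h0 x z : (0 <= h x z)%E by apply: integral_ge0.
have mh x : measurable_fun setT (h x).
  exact: measurable_fun_integral_finite_kernel.
rewrite [LHS](_ : _ =
    @run _ _ _ _ _ Rz n X pi k
      (fun z => \sum_x (w j x)%:E * h x z)%E); last first.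
  rewrite /=; congr run; apply/funext => z; rewrite jE.
  apply: (@integral_mixture _ _ R T (Rz k (z, X j)) (w j)
    (fun x => K k x j z) (fun s => f (z, s))) => //.
  - by move=> U mU; exact: RzE.
  - exact: measurable_pair_snd.
rewrite IH; last 3 first.
- exact: ltnW.
- by move=> z; apply: sume_ge0 => x _; rewrite mule_ge0 ?lee_fin.
- by apply: emeasurable_sum => x; exact: measurable_funeM.
transitivity (\sum_t (ffprob w t)%:E * \sum_x (w j x)%:E *
    @compose _ _ _ (select_pker pi t) k (h x))%E.
  apply: eq_bigr => t _; congr (_ * _)%E.
  rewrite compose_sum; last 2 first.
  - by move=> x z; rewrite mule_ge0 ?lee_fin.
  - by move=> x; exact: measurable_funeM.
  by apply: eq_bigr => x _; rewrite composeZ ?lee_fin.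
(* The component [x] freshly drawn for user [j] takes the place of [t j]. *)
rewrite (sum_ffprob_resample w_ge0 w_sum1
  (G := fun t x => @compose _ _ _ (select_pker pi t) k (h x)))//.
- apply: eq_bigr => t _; congr (_ * _)%E.
  by rewrite /= /select_pker jE.
- by move=> t x; exact: compose_ge0.
(* By injectivity of [pi], the rounds before [k] serve users other than [j] and do not see the
   changed coordinate. *)
- move=> t x y; apply: eq_compose => i ik.
  pose oi : 'I_n := Ordinal (ltn_trans ik kn).
  have iE : insub i = Some oi by exact: (valK oi).
  rewrite /select_pker iE /= ffunE ifN// (inj_eq perm_inj) -val_eqE/=.
  by rewrite ltn_eqF.
Qed.

End expansion.

(** * Splitting a private randomizer into shared and leftover kernels *)

Lemma pker_probability d d' (X : measurableType d) (Y : measurableType d')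
    (R : realType) (K : R.-pker X ~> Y) (x : X) :
  exists P : probability Y R, forall U, P U = K x U.
Proof.
apply: probability_of_set_function => //; last exact: prob_kernel.
exact: measure_semi_sigma_additive.
Qed.

Lemma pker_section d d' d'' (X : measurableType d) (Y : measurableType d')
    (Z : measurableType d'') (R : realType) (K : R.-pker (X * Y)%type ~> Z)
    (y : Y) :
  exists K' : R.-pker X ~> Z, forall x U, K' x U = K (x, y) U.
Proof.
have /choice[P PE] x := pker_probability K (x, y).
have [U mU|K' K'E] := @pker_of_probability _ _ X Z R P.
  under eq_fun do rewrite PE.
  apply: (measurableT_comp (measurable_kernel K U mU)).
  exact: pair2_measurable.
by exists K' => x U; rewrite K'E PE.
Qed.

Section clones.
Context {R : realType} {d d' dD} {X : measurableType d} {Y : measurableType d'}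
  {D : measurableType dD} {I : eqType}.
Variables (K : R.-pker (X * D)%type ~> Y) (eps : R).
Hypothesis eps_gt0 : 0 < eps.
Hypothesis dp : forall x, dp_local_randomizer eps (fun y => K (x, y)).

(* [Some true] and [Some false] are the two components shared by all users and
   [None] is the user's own leftover component; [flip] exchanges the roles of
   the two datasets. *)
Definition clone_weight (eps : R) (i0 : I) (flip : bool) (i : I)
    (o : option bool) : R :=
  if i == i0 then
    if o is Some b then bernoulli_pmf (expR eps / (expR eps + 1)) (flip (+) b)
    else 0
  else if o is Some b then expR (- eps) / 2 else 1 - expR (- eps).

Let p := expR (- eps).

Let p_gt0 : 0 < p. Proof. exact: expR_gt0. Qed.
Let p_lt1 : p < 1. Proof. by rewrite -expR0 ltr_expR oppr_lt0. Qed.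

(** With [p] as the only parameter, the decomposition identities become rational and fall to
    [field]. *)
Lemma bernoulli_expR b :
  bernoulli_pmf (expR eps / (expR eps + 1)) b =
  if b then (1 + p)^-1 else p / (1 + p).
Proof.
have -> : expR eps = p^-1 by rewrite /p expRN invrK.
have p0 := lt0r_neq0 p_gt0.
have p10 : 1 + p != 0 by rewrite lt0r_neq0// addr_gt0.
by rewrite /bernoulli_pmf; case: b; field; rewrite p0 p10.
Qed.

Lemma clone_weight_ge0 i0 flip i o : 0 <= clone_weight eps i0 flip i o.
Proof.
rewrite /clone_weight; case: ifP => _; case: o => [b|]//.
- rewrite bernoulli_expR; case: ifP => _.
    by rewrite invr_ge0 addr_ge0// ltW.
  by rewrite divr_ge0// ?addr_ge0// ltW.
- by rewrite subr_ge0 ltW.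
Qed.

Lemma sum_option_bool (V : nmodType) (F : option bool -> V) :
  \sum_o F o = F None + (F (Some true) + F (Some false)).
Proof.
rewrite (bigD1 None)//= (bigD1 (Some true))//= (bigD1 (Some false))//=.
by rewrite big1 ?addr0// => -[[]|].
Qed.

Lemma clone_weight_sum1 i0 flip i : \sum_o clone_weight eps i0 flip i o = 1.
Proof.
rewrite sum_option_bool /clone_weight; case: ifP => _.
  by rewrite add0r; case: flip; rewrite /bernoulli_pmf/=; ring.
by field.
Qed.

Lemma dp_fine x y y' U : measurable U ->
  p * fine (K (x, y') U) <= fine (K (x, y) U).
Proof.
move=> mU.
have fK z : K (x, z) U \is a fin_num.
  by have [P PE] := pker_probability K (x, z); rewrite -PE fin_num_measure.
have := dp x y' y mU.
rewrite -(fineK (fK y)) -(fineK (fK y')) -EFinM lee_fin => h.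
rewrite -(ler_pM2l (expR_gt0 eps)) mulrA /p -expRD subrr expR0 mul1r//.
Qed.

(** Solving the two equations for [i0] gives Q1 = (R(X0 i0) - p R(X1 i0)) / (1 - p), and Q0
    symmetrically. They add up to R(X0 i0) + R(X1 i0), so the shared part of any other user is p / 2
    times this sum, which determines the leftover. *)
Lemma clone_decomposition (i0 : I) (X0 X1 : I -> D) :
  (forall i, i <> i0 -> X0 i = X1 i) ->
  exists Kc : option bool -> I -> R.-pker X ~> Y,
    (forall b i j, Kc (Some b) i = Kc (Some b) j) /\
    (forall (flip : bool) i x U, measurable U ->
      K (x, (if flip then X1 else X0) i) U =
      \sum_o (clone_weight eps i0 flip i o)%:E * Kc o i x U)%E.
Proof.
move=> X01.
have /choice[Ks KsE] := pker_section K.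
have p1 : 1 - p != 0 by rewrite subr_eq0 eq_sym lt_eqF.
pose y (b : bool) := if b then X0 i0 else X1 i0.
have /choice[Q QE] b : exists Q : R.-pker X ~> Y, forall x U, measurable U ->
    Q x U = ((fine (K (x, y b) U) - p * fine (K (x, y (~~ b)) U)) / (1 - p))%:E.
  pose c b' := (if b == b' then 1 else - p) / (1 - p).
  have sumE (F : bool -> R) : \sum_b' c b' * F b' =
      (F b - p * F (~~ b)) / (1 - p).
    by rewrite big_bool {}/c; case: b => /=; ring.
  have [x U mU||Q QE] := @combination_pker _ _ X Y R bool c (fun b => Ks (y b)).
  - rewrite sumE !KsE divr_ge0 ?subr_ge0//; first exact: dp_fine.
    exact: ltW.
  - have := sumE (fun=> 1); under eq_bigr do rewrite mulr1.
    by move=> ->; rewrite mulr1 divff.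
  - by exists Q => x U mU; rewrite QE// sumE !KsE.
have /choice[L LE] i : exists L : R.-pker X ~> Y, forall x U, measurable U ->
    L x U = ((fine (K (x, X0 i) U) - p / 2 * (fine (K (x, y true) U) +
      fine (K (x, y false) U))) / (1 - p))%:E.
  pose c (o : option bool) := (if o is None then 1 else - (p / 2)) / (1 - p).
  have sumE (F : option bool -> R) : \sum_o c o * F o =
      (F None - p / 2 * (F (Some true) + F (Some false))) / (1 - p).
    by rewrite sum_option_bool /c; field.
  have [x U mU||L LE] := @combination_pker _ _ X Y R (option bool) c
    (fun o => Ks (if o is Some b then y b else X0 i)).
  - rewrite sumE !KsE divr_ge0 ?subr_ge0//; last exact: ltW.
    (* Averaging the privacy bounds against the two inputs of [i0] makes the leftover
       nonnegative. *)
    have := @dp_fine x (X0 i) (y true) U mU.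
    have := @dp_fine x (X0 i) (y false) U mU.
    lra.
  - have := sumE (fun=> 1); under eq_bigr do rewrite mulr1.
    by move=> ->; field.
  - by exists L => x U mU; rewrite LE// sumE !KsE.
exists (fun o i => if o is Some b then Q b else L i); split=> // flip i x U mU.
have fK z : K (x, z) U = (fine (K (x, z) U))%:E.
  rewrite fineK//.
  by have [P PE] := pker_probability K (x, z); rewrite -PE fin_num_measure.
rewrite sum_option_bool fK QE// QE// LE// -!EFinM -!EFinD; congr _%:E.
have p10 : 1 + p != 0 by rewrite lt0r_neq0// addr_gt0.
rewrite /clone_weight; case: eqP => [->|/X01 Xi].
  rewrite !bernoulli_expR.
  by case: flip => /=; field; rewrite p1 p10.
(* Away from [i0] the datasets agree, so the leftover built from [X0] serves both. *)
rewrite -/p (_ : (if flip then X1 else X0) i = X0 i); last by case: flip.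
by rewrite /=; field.
Qed.

End clones.

(** * Counting component assignments *)

Section classes.
Context {n : nat} (i0 : 'I_n).
Implicit Types (t : {ffun 'I_n -> option bool}) (c a : nat) (b : bool).

(** The cardinality of this set is the value of C, that of [true_clones] the value of A. User [i0]
    is excluded: its bit carries Delta. *)
Definition clones t := [set j | (j != i0) && (t j != None)]%SET.

Definition true_clones t := [set j | (j != i0) && (t j == Some true)]%SET.

Definition clone_class c a b : {set {ffun 'I_n -> option bool}} :=
  [set t : {ffun 'I_n -> option bool} |
    [&& t i0 == Some b, #|clones t| == c & #|true_clones t| == a]]%SET.

Lemma true_clones_sub t : true_clones t \subset clones t.
Proof. by apply/fintype.subsetP => j; rewrite !inE => /andP[-> /eqP->]. Qed.

Lemma card_clones t : (#|clones t| < n)%N.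
Proof.
have nE : #|[set~ i0]%SET|.+1 = n.
  by rewrite cardsC1 card_ord prednK// (leq_trans _ (ltn_ord i0)).
rewrite -[X in (_ < X)%N]nE ltnS.
apply: subset_leq_card; apply/fintype.subsetP => j.
by rewrite !inE => /andP[].
Qed.

(** A member amounts to a set of [c] users other than [i0] with a subset of size [a]. *)
Lemma card_clone_class c a b :
  #|clone_class c a b| = ('C(n.-1, c) * 'C(c, a))%N.
Proof.
pose h (p : {set 'I_n} * {set 'I_n}) : {ffun 'I_n -> option bool} :=
  [ffun j => if j == i0 then Some b
             else if j \in p.1 then Some (j \in p.2) else None].
pose h' t := (clones t, true_clones t).
have clones_h p : clones (h p) = (p.1 :\ i0)%SET.
  apply/setP => j; rewrite !inE ffunE.
  by case: eqP => //= _; case: ifP.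
have true_clones_h p : true_clones (h p) = ((p.1 :&: p.2) :\ i0)%SET.
  apply/setP => j; rewrite !inE ffunE.
  by case: eqP => //= _; case: ifP => //= _; case: (_ \in _).
(* [h] accepts all pairs; the reindexing keeps those with [h' (h p) = p], that is, with [i0] outside
   the first set and the second set inside the first. *)
rewrite -sum1_card (reindex_onto h h'); last first.
  move=> t; rewrite inE => /and3P[/eqP t0 _ _]; apply/ffunP => j.
  rewrite ffunE !inE; case: eqP => [->//|/= _].
  by case: (t j) => [[]|].
transitivity (\sum_(A in [set A : {set 'I_n} | (A \subset [set~ i0]) &&
      (#|A| == c)]%SET)
    \sum_(B in [set B : {set 'I_n} | (B \subset A) && (#|B| == a)]%SET) 1)%N.
  rewrite pair_big_dep/=; apply: eq_bigl => -[A B].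
  rewrite !inE /h' clones_h true_clones_h/= ffunE eqxx eqxx/= xpair_eqE.
  apply/idP/idP.
    move=> /and3P[/andP[Ac Ba] /eqP EA /eqP EB].
    rewrite EA in Ac; rewrite EB in Ba; rewrite Ac Ba !andbT.
    apply/andP; split.
      by rewrite -EA; apply/fintype.subsetP => j; rewrite !inE => /andP[].
    rewrite -EB; apply/fintype.subsetP => j.
    by rewrite !inE => /andP[_ /andP[]].
  move=> /andP[/andP[/fintype.subsetP A0 Ac] /andP[/fintype.subsetP BA Ba]].
  have EA : (A :\ i0 = A)%SET.
    apply/setP => j; rewrite !inE; case: eqP => //= ->.
    by apply/esym/negP => /A0; rewrite !inE eqxx.
  have EB : ((A :&: B) :\ i0 = B)%SET.
    apply/setP => j; rewrite !inE.
    have [/BA jA|jB] := boolP (j \in B); last by rewrite !andbF.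
    by have := A0 _ jA; rewrite !inE jA => ->.
  by rewrite EA EB Ac Ba !eqxx.
under eq_bigr => A.
  rewrite inE => /andP[_ /eqP Ac].
  rewrite sum1_card cards_draws Ac; over.
by rewrite sum_nat_const cards_draws cardsC1 card_ord.
Qed.

Definition swap_users t (j : 'I_n) : {ffun 'I_n -> option bool} :=
  [ffun k => t (tperm i0 j k)].

(* Double counting of the pairs of a [t] and a user with the bit opposite to
   that of [i0]. *)
Lemma sum_clone_class_swap (V : nmodType) (G : {ffun 'I_n -> option bool} -> V)
    c a :
  (forall t j, t i0 != None -> t j != None -> G (swap_users t j) = G t) ->
  (\sum_(t in clone_class c a true) G t) *+ (c - a) =
  (\sum_(t in clone_class c a.+1 false) G t) *+ a.+1.
Proof.
move=> GE.
have mulE (P : pred {ffun 'I_n -> option bool}) b m :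
    (forall t, P t -> #|[set j | (j != i0) && (t j == Some b)]%SET| = m) ->
    (\sum_(t | P t) G t) *+ m =
    \sum_(p : {ffun 'I_n -> option bool} * 'I_n |
       P p.1 && ((p.2 != i0) && (p.1 p.2 == Some b))) G p.1.
  move=> Pm; rewrite -sumrMnl.
  rewrite -(pair_big_dep P (fun t j => (j != i0) && (t j == Some b))
    (fun t _ => G t))/=.
  apply: eq_bigr => t /Pm <-.
  rewrite sumr_const; congr (_ *+ _).
  by apply: eq_card => j; rewrite !inE.
(* When [i0] holds true, the users with the opposite bit are the [c - a] clones that are not true
   clones. *)
rewrite (mulE _ false) => [|t]; last first.
  rewrite inE => /and3P[_ /eqP <- /eqP <-].
  rewrite -[in RHS](finset.setIidPr (true_clones_sub t)) -cardsD.
  apply: eq_card => j; rewrite !inE.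
  by case: (j != i0) => //=; case: (t j) => [[]|].
rewrite (mulE _ true) => [|t]; last by rewrite inE => /and3P[_ _ /eqP].
pose h (p : {ffun 'I_n -> option bool} * 'I_n) := (swap_users p.1 p.2, p.2).
have hK : involutive h.
  move=> [t j]; rewrite /h/=; congr pair; apply/ffunP => k.
  by rewrite !ffunE tpermK.
rewrite (reindex_inj (inv_inj hK))/=.
(* As [i0] and [j] both hold shared components, the exchange keeps the set of clones and only
   removes [j] from the true ones. *)
have PE t j : (swap_users t j \in clone_class c a true) &&
      ((j != i0) && (swap_users t j j == Some false)) =
    (t \in clone_class c a.+1 false) && ((j != i0) && (t j == Some true)).
  rewrite !inE !ffunE tpermL tpermR.
  have [->|ji] := eqVneq j i0; first by rewrite !andbF.
  have [tj|] := eqVneq (t j) (Some true); last by rewrite !andbF.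
  have [ti|] := eqVneq (t i0) (Some false); last by rewrite !andbF.
  have -> : clones (swap_users t j) = clones t.
    apply/setP => k; rewrite !inE ffunE.
    have [//|ki] := eqVneq k i0.
    have [->|kj] := eqVneq k j; first by rewrite tpermR ti tj.
    by rewrite tpermD// eq_sym.
  have -> : true_clones (swap_users t j) = (true_clones t :\ j)%SET.
    apply/setP => k; rewrite !inE ffunE.
    have [->|ki] := eqVneq k i0; first by rewrite andbF.
    have [->|kj] := eqVneq k j; first by rewrite tpermR ti.
    by rewrite tpermD// eq_sym.
  rewrite (cardsD1 j (true_clones t)) [j \in _]inE ji tj/= add1n eqSS.
  by rewrite !andbT.
under eq_bigl do rewrite PE.
apply: eq_bigr => -[t j] /andP[] /=.
rewrite inE => /and3P[/eqP ti _ _] /andP[_ /eqP tj].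
by rewrite GE// ?ti ?tj.
Qed.

(** An assignment with a bit at [i0] lies in exactly one class, read off from that bit and the two
    cardinalities; the others contribute 0. *)
Lemma sum_clone_classes (V : nmodType) (F : {ffun 'I_n -> option bool} -> V) :
  (forall t, t i0 = None -> F t = 0) ->
  \sum_t F t =
  \sum_(c < n) \sum_(a < c.+1) \sum_(b : bool)
    \sum_(t in clone_class c a b) F t.
Proof.
move=> F0.
under [RHS]eq_bigr => c _.
  under eq_bigr => a _.
    under eq_bigr => b _ do rewrite big_mkcond/=.
    rewrite exchange_big/=; over.
  rewrite exchange_big/=; over.
rewrite exchange_big/=; apply: eq_bigr => t _.
have [/F0 Ft|] := eqVneq (t i0) None.
  rewrite big1// => c _; rewrite big1// => a _; rewrite big1// => b _.
  by rewrite Ft if_same.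
case tE : (t i0) => [b0|//] _.
pose c0 := Ordinal (card_clones t).
have a0_lt : (#|true_clones t| < c0.+1)%N.
  by rewrite ltnS subset_leq_card// true_clones_sub.
rewrite (bigD1 c0)//= [X in _ + X]big1 ?addr0; last first.
  move=> c cc; rewrite big1// => a _; rewrite big1// => b _.
  rewrite ifF// !inE; apply/negP => /and3P[_ /eqP cE _].
  by move/eqP: cc; apply; apply: val_inj.
rewrite (bigD1 (Ordinal a0_lt))//= [X in _ + X]big1 ?addr0; last first.
  move=> a aa; rewrite big1// => b _.
  rewrite ifF// !inE; apply/negP => /and3P[_ _ /eqP aE].
  by move/eqP: aa; apply; apply: val_inj.
rewrite (bigD1 b0)//= [X in _ + X]big1 ?addr0; last first.
  move=> b bb; rewrite ifF// !inE; apply/negP => /and3P[/eqP + _ _].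
  by rewrite tE => -[E]; rewrite E eqxx in bb.
by rewrite inE tE !eqxx.
Qed.

End classes.

(** * Uniform averages of probabilities *)

Section averaging.
Context {R : realType} {d} {T : measurableType d} {J I : finType}
  (P : J * I -> probability T R).

(** With [J] the permutations and [I] the assignments, this is the shuffled probability of [E] for a
    fixed assignment. *)
Definition average (E : set T) (t : I) : R :=
  (#|J|%:R)^-1 * \sum_j fine (P (j, t) E).

Lemma average_probability (A : {set I}) : (0 < #|J|)%N -> (0 < #|A|)%N ->
  exists Q : probability T R, forall E, measurable E ->
    Q E = ((\sum_(t in A) average E t) / #|A|%:R)%:E.
Proof.
move=> J0 A0.
have J0' : #|J|%:R != 0 :> R by rewrite pnatr_eq0 -lt0n.
have A0' : #|A|%:R != 0 :> R by rewrite pnatr_eq0 -lt0n.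
pose c (p : J * I) : R :=
  if p.2 \in A then (#|J|%:R)^-1 / #|A|%:R else 0.
have cE (F : J * I -> R) : \sum_p c p * F p =
    (\sum_(t in A) (#|J|%:R)^-1 * \sum_j F (j, t)) / #|A|%:R.
  transitivity (\sum_p c (p.1, p.2) * F (p.1, p.2)).
    by apply: eq_bigr => -[].
  rewrite -(pair_bigA _ (fun j t => c (j, t) * F (j, t)))/= exchange_big/=.
  rewrite mulr_suml [RHS]big_mkcond/=; apply: eq_bigr => t _.
  rewrite /c/=; case: ifP => _; last by rewrite big1// => j _; rewrite mul0r.
  by rewrite -mulr_sumr mulrAC.
have [U mU||Q QE] := @combination_probability _ T R _ c P.
- rewrite cE divr_ge0// sumr_ge0// => t _.
  by rewrite mulr_ge0 ?invr_ge0// sumr_ge0// => j _; rewrite fine_ge0.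
- have := cE (fun=> 1); under eq_bigr do rewrite mulr1.
  move=> ->; rewrite !sumr_const.
  by rewrite (eq_card (B := J))// mulVf// divff.
by exists Q => E mE; rewrite QE// cE.
Qed.

End averaging.

(** * The shuffled law as a mixture of class averages *)

Section shuffled_clones.
Context {R : realType} {dD} {D : measurableType dD}
  (Sd : nat -> measure_display) (S : forall i, measurableType (Sd i))
  (Rz : forall k : nat, R.-pker (hist S k * D)%type ~> S k) (n : nat).
Context (eps : R) (X : bool -> 'I_n -> D) (i0 : 'I_n)
  (K : forall k : nat, option bool -> 'I_n -> R.-pker hist S k ~> S k).
Hypothesis eps_gt0 : 0 < eps.
Hypothesis K_shared : forall k b i j, K k (Some b) i = K k (Some b) j.
Hypothesis RzE : forall k, (k < n)%N ->
  forall (flip : bool) i (z : hist S k) U, measurable U ->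
    (Rz k (z, X flip i) U =
     \sum_o (clone_weight eps i0 flip i o)%:E * K k o i z U)%E.

Implicit Type t : {ffun 'I_n -> option bool}.

(** Composing each permutation with the transposition of [i0] and [j] makes every round use the same
    component on both sides. Only the user label of two rounds differs, and shared kernels ignore
    it. *)
Lemma sum_compose_swap t j f : t i0 != None -> t j != None ->
  (\sum_pi @compose _ _ _ (select_pker K i0 pi (swap_users i0 t j)) n f =
   \sum_pi @compose _ _ _ (select_pker K i0 pi t) n f)%E.
Proof.
move=> ti tj.
rewrite [RHS](reindex_inj (mulIg (tperm i0 j)))/=.
apply: eq_bigr => pi _; apply: eq_compose => k _.
rewrite /select_pker permM ffunE; set l := pi _.
case tl : (t (tperm i0 j l)) => [b|]; first exact: K_shared.
(* A leftover component belongs to neither [i0] nor [j], so the transposition fixes its user. *)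
congr (K _ _); case: tpermP tl => // ->.
  by move=> tj0; rewrite tj0 in tj.
by move=> ti0; rewrite ti0 in ti.
Qed.

(** The product splits into [i0], the [c] clones and the other users. The value is free of [a]
    because Q1 and Q0 have equal weights outside [i0]. *)
Lemma ffprob_clone_class flip c a b t : t \in clone_class i0 c a b ->
  ffprob (clone_weight eps i0 flip) t =
  bernoulli_pmf (expR eps / (expR eps + 1)) (flip (+) b) *
  ((expR (- eps) / 2) ^+ c * (1 - expR (- eps)) ^+ (n.-1 - c)).
Proof.
rewrite inE => /and3P[/eqP ti /eqP cE _].
rewrite /ffprob (bigD1 i0)//= {1}/clone_weight eqxx ti; congr (_ * _).
rewrite (bigID (fun j => j \in clones i0 t))/=; congr (_ * _).
  rewrite -cE -prodr_const; apply: eq_big => j.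
    by rewrite inE; case: (j != i0).
  rewrite inE => /andP[ji /andP[_ tj]].
  by rewrite /clone_weight (negbTE ji); case: (t j) tj.
have -> : (n.-1 - c)%N = #|[set~ i0] :\: clones i0 t|%SET.
  rewrite cardsD cardsC1 card_ord (finset.setIidPr _) ?cE//.
  by apply/fintype.subsetP => j; rewrite !inE => /andP[].
rewrite -prodr_const; apply: eq_big => j.
  by rewrite !inE andbC.
rewrite !inE => /andP[ji]; rewrite ji/= negbK => /eqP tj.
by rewrite /clone_weight (negbTE ji) tj.
Qed.

Context (P : {perm 'I_n} * {ffun 'I_n -> option bool} ->
  probability (hist S n) R).
Hypothesis PE : forall pi t E,
  P (pi, t) E = @compose _ _ _ (select_pker K i0 pi t) n (fun z => (\1_E z)%:E).

Definition class_average E c a b : R :=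
  (\sum_(t in clone_class i0 c a b) average P E t) / #|clone_class i0 c a b|%:R.

(** Counting [i0], both classes have a + 1 Q1's and c - a Q0's. Double counting relates the two sums
    by the factors c - a and a + 1, and the class sizes have the matching ratio since (a + 1) C(c, a
    + 1) = (c - a) C(c, a). *)
Lemma class_average_swap E c a : measurable E -> (c < n)%N -> (a < c)%N ->
  class_average E c a true = class_average E c a.+1 false.
Proof.
move=> mE cn ac.
have GE (t : {ffun 'I_n -> option bool}) j : t i0 != None -> t j != None ->
    average P E (swap_users i0 t j) = average P E t.
  move=> ti tj.
  rewrite /average; congr (_ * _); apply: EFin_inj.
  rewrite -!sumEFin.
  have PfE t' : (\sum_pi (fine (P (pi, t') E))%:E = \sum_pi
      @compose _ _ _ (select_pker K i0 pi t') n (fun z => (\1_E z)%:E))%E.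
    by apply: eq_bigr => pi _; rewrite fineK ?PE// -PE fin_num_measure.
  by rewrite !PfE sum_compose_swap.
have := sum_clone_class_swap c a GE.
rewrite /class_average !card_clone_class.
set s1 := \sum_(t in _) _; set s2 := \sum_(t in _) _ => s12.
have cn' : (c <= n.-1)%N by rewrite -ltnS prednK// (leq_ltn_trans _ cn).
have C0 (m k : nat) : (k <= m)%N -> 'C(m, k)%:R != 0 :> R.
  by move=> km; rewrite pnatr_eq0 -lt0n bin_gt0.
apply/eqP; rewrite eqr_div ?natrM ?mulf_neq0 ?C0//; last exact: ltnW.
(* A factor a + 1 is inserted so that the binomial identity and then the double counting apply. *)
have a0 : a.+1%:R != 0 :> R by rewrite pnatr_eq0.
apply/eqP/(mulIf a0).
rewrite -[s1 *+ _]mulr_natr -[s2 *+ _]mulr_natr in s12.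
have /(congr1 (fun m => m%:R : R)) := mul_bin_left c a; rewrite !natrM => bE.
transitivity (s1 * 'C(n.-1, c)%:R * (a.+1%:R * 'C(c, a.+1)%:R)).
  by rewrite !mulrA -!mulrA [_%:R * a.+1%:R]mulrC.
rewrite bE.
transitivity ((s1 * (c - a)%:R) * ('C(n.-1, c)%:R * 'C(c, a)%:R)).
  by ring.
by rewrite s12; ring.
Qed.

Lemma shuffle_law_average flip E : measurable E ->
  shuffle_law Rz (X flip) E =
  (\sum_t ffprob (clone_weight eps i0 flip) t * average P E t)%:E.
Proof.
move=> mE.
have w0 := clone_weight_ge0 eps_gt0 i0 flip.
have w1 := clone_weight_sum1 eps i0 flip.
have runE (pi : {perm 'I_n}) :
    @run _ _ _ _ _ Rz n (X flip) pi n (fun z => (\1_E z)%:E) =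
    (\sum_t ffprob (clone_weight eps i0 flip) t * fine (P (pi, t) E))%:E.
  rewrite (run_mixture (K := K) i0 w0 w1)//.
  - rewrite -sumEFin; apply: eq_bigr => t _.
    by rewrite EFinM fineK ?PE// -PE fin_num_measure.
  - by move=> k kn j z U mU; exact: RzE.
  - by apply/measurable_EFinP; exact: measurable_indic.
rewrite /shuffle_law; under eq_bigr do rewrite runE.
rewrite sumEFin -EFinM exchange_big/= mulr_sumr; congr _%:E.
apply: eq_bigr => t _.
rewrite -mulr_sumr mulrCA /average; congr (_ * (_^-1 * _)).
by rewrite -card_Sn; congr _%:R; apply: eq_card => pi; rewrite !inE.
Qed.

(** All members of a class have the same weight; times the class size C(n - 1, c) C(c, a), it is the
    joint mass of C, A and Delta. *)
Lemma shuffle_law_clones flip E : measurable E ->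
  shuffle_law Rz (X flip) E =
  (\sum_(c < n) \sum_(a < c.+1) \sum_(delta : bool)
    (CADelta_pmf n eps c a delta)%:E *
    (class_average E c a (flip (+) delta))%:E)%E.
Proof.
move=> mE; rewrite shuffle_law_average// (sum_clone_classes (i0 := i0)).
  rewrite -sumEFin; apply: eq_bigr => c _.
  rewrite -sumEFin; apply: eq_bigr => a _.
  (* Delta is [flip (+) b], where [b] is the bit of [i0]. *)
  rewrite -sumEFin (reindex_inj (can_inj (addKb flip)))/=.
  apply: eq_bigr => delta _; rewrite -EFinM; congr _%:E.
  under eq_bigr => t tE do rewrite (ffprob_clone_class flip tE) addKb.
  rewrite -mulr_sumr /class_average; set s := \sum_(t in _) _.
  have cn : (c <= n.-1)%N.
    by rewrite -ltnS prednK// (leq_ltn_trans _ (ltn_ord c)).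
  have ac : (a <= c)%N by rewrite -ltnS.
  rewrite card_clone_class /CADelta_pmf /binomial_pmf /unstable.onem.
  rewrite -(mulr_natr _ 'C(n.-1, c)) -(mulr_natr _ 'C(c, a)) natrM.
  have -> : 1 - 2^-1 = 2^-1 :> R by field.
  rewrite -exprD subnKC// exprMn.
  have C1 : 'C(n.-1, c)%:R != 0 :> R by rewrite pnatr_eq0 -lt0n bin_gt0.
  have C2 : 'C(c, a)%:R != 0 :> R by rewrite pnatr_eq0 -lt0n bin_gt0.
  by field; rewrite C1 C2.
move=> t ti; rewrite /ffprob (bigD1 i0)//= {1}/clone_weight eqxx ti.
by rewrite !mul0r.
Qed.

End shuffled_clones.

(** * Construction of the post-processing *)

Theorem theorem3p2 (R : realType) (n : nat) (eps0 : R) (dD : measure_display)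
  (D : measurableType dD) (Sd : nat -> measure_display)
  (S : forall i, measurableType (Sd i))
  (Rz : forall k : nat, R.-pker (hist S k * D)%type ~> S k) :
  0 < eps0 ->
  (forall k : nat, (k < n)%N -> forall z : hist S k,
     dp_local_randomizer eps0 (fun x : D => Rz k (z, x))) ->
  forall X0 X1 : 'I_n -> D, neighboring X0 X1 ->
  exists Phi : nat -> nat -> probability (hist S n) R,
    (forall E : set (hist S n), measurable E ->
      shuffle_law Rz X0 E =
      (\sum_(c < n) \sum_(a < c.+1) \sum_(delta : bool)
         (CADelta_pmf n eps0 c a delta)%:E *
         Phi (a + delta)%N (c - a + 1 - delta)%N E)%E) /\
    (forall E : set (hist S n), measurable E ->
      shuffle_law Rz X1 E =
      (\sum_(c < n) \sum_(a < c.+1) \sum_(delta : bool)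
         (CADelta_pmf n eps0 c a delta)%:E *
         Phi (a + 1 - delta)%N (c - a + delta)%N E)%E).
Proof.
move=> eps_gt0 dp X0 X1 [i0 [_ /(_ _ _)/esym X01]].
pose X (flip : bool) := if flip then X1 else X0.
have K_ex k : exists K : option bool -> 'I_n -> R.-pker hist S k ~> S k,
    (forall b i j, K (Some b) i = K (Some b) j) /\
    ((k < n)%N -> forall (flip : bool) i (z : hist S k) U, measurable U ->
      Rz k (z, X flip i) U =
      \sum_o (clone_weight eps0 i0 flip i o)%:E * K o i z U)%E.
  have [kn|_] := ltnP k n; last first.
    (* Privacy is assumed for the first [n] rounds; later ones get an arbitrary kernel. *)
    by have [K' _] := pker_section (Rz k) (X0 i0); exists (fun _ _ => K').
  have [i /X01 //|K [Ks KE]] :=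
    clone_decomposition eps_gt0 (dp k kn) (i0 := i0) (X0 := X0) (X1 := X1).
  by exists K.
pose K k := sval (cid (K_ex k)).
have K_shared k : forall b i j, K k (Some b) i = K k (Some b) j.
  by rewrite /K; case: cid => ? [].
have RzE k : (k < n)%N -> forall (flip : bool) i (z : hist S k) U,
    measurable U -> (Rz k (z, X flip i) U =
    \sum_o (clone_weight eps0 i0 flip i o)%:E * K k o i z U)%E.
  by rewrite /K; case: cid => ? [].
have /choice[P PE'] (p : {perm 'I_n} * {ffun 'I_n -> option bool}) :=
  compose_probability (select_pker K i0 p.1 p.2) n.
have PE pi t E : P (pi, t) E =
    compose (select_pker K i0 pi t) (fun z => (\1_E z)%:E) by rewrite PE'.
(* The pair counts all Q1's and Q0's, that of [i0] included, so C is u + v - 1. The representative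
   class gives [i0] a Q1 whenever there is one. *)
pose Phi_class u v := if u is u'.+1 then clone_class i0 (u + v).-1 u' true
                      else clone_class i0 (u + v).-1 u false.
have /choice[Phi PhiE] (uv : nat * nat) : exists Q : probability (hist S n) R,
    (0 < #|Phi_class uv.1 uv.2|)%N -> forall E, measurable E ->
    Q E = ((\sum_(t in Phi_class uv.1 uv.2) average P E t) /
      #|Phi_class uv.1 uv.2|%:R)%:E.
  (* The class is empty when u + v > n; an arbitrary probability is used there. *)
  have [_|A0] := posnP #|Phi_class uv.1 uv.2|.
    by exists (P (1%g, [ffun=> None])).
  have [|Q QE] := average_probability P _ A0; last by exists Q.
  by apply/card_gt0P; exists 1%g.
have avgE c a (b : bool) E : measurable E -> (c < n)%N -> (a <= c)%N ->
    Phi ((a + b)%N, (c - a + 1 - b)%N) E = (class_average i0 P E c a b)%:E.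
  move=> mE cn ac.
  have C0 a' b' : (a' <= c)%N -> (0 < #|clone_class i0 c a' b'|)%N.
    move=> a'c; rewrite card_clone_class muln_gt0 !bin_gt0 a'c andbT.
    by rewrite -ltnS prednK// (leq_ltn_trans _ cn).
  have clE u v a' b' : Phi_class u v = clone_class i0 c a' b' -> (a' <= c)%N ->
      Phi (u, v) E = (class_average i0 P E c a' b')%:E.
    move=> uvE a'c; have := PhiE (u, v).
    by rewrite [Phi_class _ _]uvE => -> //; exact: C0.
  case: b.
    apply: clE => //; rewrite [(a + _)%N]addn1 /Phi_class.
    by congr clone_class; lia.
  case: a ac => [|a] ac.
    by apply: clE => //; rewrite /Phi_class; congr clone_class; lia.
  (* Here [i0] holds Q0 but some Q1 is present, so the average moves to the representative class. *)
  rewrite -(class_average_swap K_shared PE)//.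
  apply: clE; last exact: ltnW.
  by rewrite [(_ + false)%N]addn0 /Phi_class; congr clone_class; lia.
exists (fun u v => Phi (u, v)); split => E mE.
  rewrite (shuffle_law_clones eps_gt0 RzE PE false mE).
  apply: eq_bigr => c _; apply: eq_bigr => a _; apply: eq_bigr => delta _.
  by rewrite avgE// -ltnS.
rewrite (shuffle_law_clones eps_gt0 RzE PE true mE).
apply: eq_bigr => c _; apply: eq_bigr => a _; apply: eq_bigr => delta _.
have ac : (a <= c)%N by rewrite -ltnS.
(* On [X1] the bit of [i0] is the negation of [delta], hence a + 1 - delta Q1's in total. *)
rewrite -avgE//; congr (_ * Phi (_, _) E)%E; case: delta => /=; lia.
Qed.
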